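(* Let $a<a_0<b_0<b$ be real numbers and let $\ell,r,q\in\overline{\mathbb N}_0$ with $\ell,r\le q$. Let $\mathcal{B}_{L}$ be a leftward blend-to-zero operator on $C^{q}[a_{0},b_{0}]$ of orders $\ell$ and $r$, and let $\mathcal{B}_{R}$ be a rightward blend-to-zero operator on $C^{q}[a_{0},b_{0}]$ of the same orders $\ell$ and $r$. Let $f\in C^{q}[a,b_{0}]$ and $g\in C^{q}[a_{0},b]$. Define $f_{0}=\mathcal{B}_{R}(f|_{[a_0,b_0]})$, $g_{0}=\mathcal{B}_{L}(g|_{[a_0,b_0]})$, and $h_{0}=f_{0}+g_{0}$. Then $h_0\in C^{q}[a_{0},b_{0}]$ and $$h_0^{(j)}(a_{0})=f^{(j)}(a_{0}),\quad j=0,\dots,\ell,\qquad h_0^{(k)}(b_{0})=g^{(k)}(b_{0}),\quad k=0,\dots,r.$$ Furthermore, the piecewise function $h:[a,b]\to\mathbb R$ given by $h(x)=f(x)$ for $a\le x<a_0$, $h(x)=h_0(x)$ for $a_0\le x\le b_0$, and $h(x)=g(x)$ for $b_0<x\le b$ is a smooth transition function of orders $\ell$ and $r$ from $f$ to $g$ over $[a_0,b_0]$.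
   Context: $\overline{\mathbb N}_0=\{0,1,2,\dots\}\cup\{\infty\}$. When an order equals $\infty$, the corresponding conditions are understood to hold for every finite derivative order. $C^n[a,b]$ denotes the real-valued $n$-times continuously differentiable functions on $[a,b]$ (one-sided derivatives at endpoints). Blend-to-zero operators: let $\ell,r\le q$. An operator (not necessarily linear) $\mathcal{B}_{R}:C^{q}[a_{0},b_{0}]\to C^{q}[a_{0},b_{0}]$ is a rightward blend-to-zero operator of orders $\ell$ and $r$ if for all $f\in C^{q}[a_{0},b_{0}]$ the function $f_0=\mathcal{B}_R(f)$ satisfies $f_0^{(j)}(a_0)=f^{(j)}(a_0)$ for $j=0,\dots,\ell$ and $f_0^{(k)}(b_0)=0$ for $k=0,\dots,r$. An operator $\mathcal{B}_{L}:C^{q}[a_{0},b_{0}]\to C^{q}[a_{0},b_{0}]$ is a leftward blend-to-zero operator of orders $\ell$ and $r$ if for all $g\in C^{q}[a_{0},b_{0}]$ the function $g_0=\mathcal{B}_L(g)$ satisfies $g_0^{(j)}(a_0)=0$ for $j=0,\dots,\ell$ and $g_0^{(k)}(b_0)=g^{(k)}(b_0)$ for $k=0,\dots,r$. Smooth transition function: let $a<a_0<b_0<b$, let $\ell\le m$ and $r\le n$ in $\overline{\mathbb N}_0$, let $f\in C^m[a,b_0]$ and $g\in C^n[a_0,b]$. A smooth transition function of orders $\ell$ and $r$ from $f$ to $g$ over $[a_0,b_0]$ is a function $h\in C^{\min\{\ell,r\}}[a,b]$ such that (i) $h(x)=f(x)$ for $a\le x\le a_0$; (ii) $h(x)=g(x)$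 for $b_0\le x\le b$; (iii) $h$ is $\ell$-times continuously differentiable at $x=a_0$; (iv) $h\in C^{\max\{\ell,r\}}(a_0,b_0)$; (v) $h$ is $r$-times continuously differentiable at $x=b_0$. *)

(* Defs.v *)
From HB Require Import structures.
From mathcomp Require Import all_boot all_order all_algebra.
From mathcomp Require Import all_classical all_reals all_analysis.

Set Implicit Arguments.
Unset Strict Implicit.
Unset Printing Implicit Defensive.

Import Order.TTheory GRing.Theory Num.Theory.
Import numFieldNormedType.Exports.

Local Open Scope classical_set_scope.
Local Open Scope ring_scope.

(* Smoothness orders, {0, 1, 2, ...} together with oo; [None] is oo. *)
Definition xnat := option nat.

Definition leo (m n : xnat) : bool :=
  match m, n with
  | _, None => true
  | None, Some _ => false
  | Some i, Some j => (i <= j)%N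
  end.

Definition mino (m n : xnat) : xnat := if leo m n then m else n.
Definition maxo (m n : xnat) : xnat := if leo m n then n else m.

Section Smoothness.
Context {R : realType}.
Implicit Types (D : set R) (f g h : R -> R) (B : (R -> R) -> (R -> R)).

(* Functions on a set D are represented by total functions R -> R whose values
   outside D are irrelevant: for x in D, the notions below only use the values
   of f on D.  At an endpoint of an interval D the derivative is one-sided, and
   at an interior point it is the usual one. *)
Definition diff_quot f (x y : R) : R := (f y - f x) / (y - x).

Definition derivable_in D f (x : R) : Prop :=
  cvg (diff_quot f x y @[y --> within D x^']).

Definition derive_in D f (x : R) : R :=
  lim (diff_quot f x y @[y --> within D x^']).

Definition nderive_in D (k : nat) f : R -> R := iter k (derive_in D) f.

(* f is of class C^n on D; for n = oo this ranges over all finite orders. *)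
Definition class_C (n : xnat) D f : Prop :=
  forall k : nat, leo (Some k) n ->
    (forall j : nat, (j < k)%N ->
       forall x : R, D x -> derivable_in D (nderive_in D j f) x) /\
    {within D, continuous (nderive_in D k f)}.

(* f is n-times continuously differentiable at the point x: for every finite
   k <= n it is of class C^k on some neighbourhood of x. *)
Definition class_C_at (n : xnat) f (x : R) : Prop :=
  forall k : nat, leo (Some k) n ->
    exists2 e : R, 0 < e & class_C (Some k) `]x - e, x + e[ f.

(* B is a (not necessarily linear) map C^q[a0, b0] -> C^q[a0, b0]; the second
   component says that B only sees its argument as a function on [a0, b0]. *)
Definition operator_C (a0 b0 : R) (q : xnat) B : Prop :=
  (forall f, class_C q `[a0, b0] f -> class_C q `[a0, b0] (B f)) /\
  (forall f g, class_C q `[a0, b0] f -> class_C q `[a0, b0] g ->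
     {in `[a0, b0], f =1 g} -> {in `[a0, b0], B f =1 B g}).

Definition rightward_blend (a0 b0 : R) (q l r : xnat) B : Prop :=
  operator_C a0 b0 q B /\
  forall f, class_C q `[a0, b0] f ->
    (forall j : nat, leo (Some j) l ->
       nderive_in `[a0, b0] j (B f) a0 = nderive_in `[a0, b0] j f a0) /\
    (forall k : nat, leo (Some k) r -> nderive_in `[a0, b0] k (B f) b0 = 0).

Definition leftward_blend (a0 b0 : R) (q l r : xnat) B : Prop :=
  operator_C a0 b0 q B /\
  forall g, class_C q `[a0, b0] g ->
    (forall j : nat, leo (Some j) l -> nderive_in `[a0, b0] j (B g) a0 = 0) /\
    (forall k : nat, leo (Some k) r ->
       nderive_in `[a0, b0] k (B g) b0 = nderive_in `[a0, b0] k g b0).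

(* h is a smooth transition function of orders l and r from f (given on
   [a, b0]) to g (given on [a0, b]) over [a0, b0]. *)
Record smooth_transition (a a0 b0 b : R) (l r : xnat) f g h : Prop := {
  transition_C : class_C (mino l r) `[a, b] h ;
  transition_left : {in `[a, a0], h =1 f} ;
  transition_right : {in `[b0, b], h =1 g} ;
  transition_C_at_left : class_C_at l h a0 ;
  transition_C_inside : class_C (maxo l r) `]a0, b0[ h ;
  transition_C_at_right : class_C_at r h b0 }.

End Smoothness.

(* Main.v *)
Require Import Defs.
From HB Require Import structures.
From mathcomp Require Import all_boot all_order all_algebra.
From mathcomp Require Import all_classical all_reals all_analysis.
From mathcomp Require Import lra.

Import Order.TTheory GRing.Theory Num.Theory.
Import numFieldNormedType.Exports.

Local Open Scope classical_set_scope.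
Local Open Scope ring_scope.

(** Smoothness on a set is handled through towers: a tower of order n on D is a
    sequence F 0, F 1, ... in which each term is the derivative of the previous
    one relative to D, with continuous terms, up to order n.  On a set without
    isolated points limits of difference quotients are unique, so a function is
    of class C^n exactly when it starts a tower, and the tower then consists of
    its iterated derivatives ([tower_nderive], [tower_class_C],
    [class_C_tower]).

    Towers behave better than iterated limits: they restrict to subsets, they
    add up, and, above all, they glue ([tower_setU]): a sequence that is a tower
    on each of two closed sets is a tower on their union.  Indeed a limit along
    a union is a limit along both parts, and at a point outside one of the
    closed parts that part imposes no condition.

    The theorem follows.  Adding the towers of the two blended functions gives
    the tower of the sum, whose values at the left end are those of f plus 0
    and at the right end 0 plus those of g.  The sequence obtained by pasting,
    order by order, the derivatives of f, of the sum and of g therefore agrees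
    at the left joint with the derivatives of f up to order l, and at the right
    joint with those of g up to order r.  Gluing at one joint gives the
    smoothness at that joint, and gluing at both joints, where only the orders
    up to the smaller of l and r match, gives the smoothness on the whole
    interval. *)

(** * Smoothness orders *)

Lemma leo_trans (m n p : xnat) : leo m n -> leo n p -> leo m p.
Proof. by case: m n p => [i|] [j|] [k|] //=; exact: leq_trans. Qed.

Lemma leoS (j : nat) (n : xnat) : leo (Some j.+1) n -> leo (Some j) n.
Proof. by case: n => //= n; exact: ltnW. Qed.

Lemma leo_minl (m n : xnat) : leo (mino m n) m.
Proof.
by rewrite /mino; case: m n => [i|] [j|] //=; case: (leqP i j) => //= /ltnW.
Qed.

Lemma leo_minr (m n : xnat) : leo (mino m n) n.
Proof. by rewrite /mino; case: m n => [i|] [j|] //=; case: (leqP i j) => /=. Qed.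

Lemma maxo_leo (m n p : xnat) : leo m p -> leo n p -> leo (maxo m n) p.
Proof. by rewrite /maxo; case: ifP. Qed.

(** * Towers of derivatives *)

Section Towers.
Context {R : realType}.
Implicit Types (D A B : set R) (f : R -> R) (F G : nat -> R -> R) (n : xnat).

Definition tower n D F : Prop :=
  (forall j, leo (Some j.+1) n -> forall x, D x ->
     diff_quot (F j) x y @[y --> within D x^'] --> F j.+1 x) /\
  (forall k, leo (Some k) n -> {within D, continuous (F k)}).

Lemma tower_leo m n D F : leo m n -> tower n D F -> tower m D F.
Proof.
by move=> mn [dF cF]; split=> j jm; [apply: dF|apply: cF];
  exact: leo_trans jm mn.
Qed.

Lemma tower_subset n A D F : A `<=` D -> tower n D F -> tower n A F.
Proof.
move=> AD [dF cF]; split=> [j jn x /AD Dx|k kn]; last first.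
  exact: continuous_subspaceW AD (cF k kn).
move=> P /(dF j jn x Dx) DP.
by apply: (@filterS _ x^') DP => y + /AD.
Qed.

Lemma diff_quot_eq_cvg D f f1 (x : R) : {in D, f =1 f1} -> D x ->
  diff_quot f x y @[y --> within D x^'] `=>`
  diff_quot f1 x y @[y --> within D x^'].
Proof.
move=> ff1 Dx; apply: near_eq_cvg; apply: (@nearW _ x^') => y Dy.
by rewrite /diff_quot !ff1 ?inE.
Qed.

Lemma tower_eq n D F G : (forall j, leo (Some j) n -> {in D, F j =1 G j}) ->
  tower n D F -> tower n D G.
Proof.
move=> FG [dF cF]; split=> [j jn x Dx|k kn]; last first.
  exact: subspace_eq_continuous (FG k kn) (cF k kn).
rewrite -FG ?inE//; apply: cvg_trans (dF j jn x Dx).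
by apply: diff_quot_eq_cvg => // y Dy; rewrite FG//; exact: leoS.
Qed.

Lemma towerD n D F G : tower n D F -> tower n D G ->
  tower n D (fun j x => F j x + G j x).
Proof.
move=> [dF cF] [dG cG]; split=> [j jn x Dx|k kn x].
  have -> : diff_quot (fun x => F j x + G j x) x =
            (fun y => diff_quot (F j) x y + diff_quot (G j) x y).
    by apply/funext => y; rewrite /diff_quot opprD addrACA mulrDl.
  exact: cvgD (dF j jn x Dx) (dG j jn x Dx).
exact: continuousD (cF k kn x) (cG k kn x).
Qed.

(** A point off a closed set has a neighbourhood missing that set, so the
    punctured neighbourhoods within it are trivial and every limit holds. *)
Lemma tower_closed_cvg n A F j x : closed A -> tower n A F ->
  leo (Some j.+1) n ->
  diff_quot (F j) x y @[y --> within A x^'] --> F j.+1 x.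
Proof.
move=> clA [dF _] jn; have [Ax|nAx] := pselect (A x); first exact: dF.
have nA : x^' (~` A).
  by apply: nbhs_dnbhs; apply: open_nbhs_nbhs; split=> //; exact: closed_openC.
by move=> P _; apply: (@filterS _ x^') nA => y nAy.
Qed.

Lemma tower_setU n A B F : closed A -> closed B ->
  tower n A F -> tower n B F -> tower n (A `|` B) F.
Proof.
move=> clA clB tA tB; split=> [j jn x _ P FP|k kn]; last first.
  by apply: withinU_continuous => //; [exact: tA.2|exact: tB.2].
have := tower_closed_cvg n B F j x clB tB jn P FP.
have := tower_closed_cvg n A F j x clA tA jn P FP.
apply: (@filterS2 _ x^') => y AP BP [/AP|/BP]; exact.
Qed.

(** * Towers and iterated derivatives *)

(** Uniqueness of derivatives at x, that is, of limits of difference quotients,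
    is the properness of this filter. *)
Definition perfect_in D : Prop :=
  forall x, D x -> ProperFilter (within D x^').

Lemma interval_perfect_in (D : set R) : is_interval D ->
  (forall x, D x -> exists2 y, D y & y != x) -> perfect_in D.
Proof.
move=> iD ntD x Dx; have [y Dy yx] := ntD x Dx.
apply: Build_ProperFilter_ex => P PD.
have {PD}nP : \forall z \near nbhs x, z != x -> D z -> P z by [].
have [xy|yx'|xy] := ltgtP x y; last by rewrite xy eqxx in yx.
- near (x^'+) => z; exists z.
  have zx : x < z by near: z; exact: nbhs_right_gt.
  have zy : z < y by near: z; exact: nbhs_right_lt.
  have Dz : D z by apply: (iD _ _ Dx Dy); rewrite !ltW.
  have : z != x -> D z -> P z by near: z; apply: cvg_within nP.
  by apply; rewrite // gt_eqF.
- near (x^'-) => z; exists z.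
  have zx : z < x by near: z; exact: nbhs_left_lt.
  have zy : y < z by near: z; exact: nbhs_left_gt.
  have Dz : D z by apply: (iD _ _ Dy Dx); rewrite !ltW.
  have : z != x -> D z -> P z by near: z; apply: cvg_within nP.
  by apply; rewrite // lt_eqF.
Unshelve. all: by end_near. Qed.

Lemma perfect_itvcc (u v : R) : u < v -> perfect_in `[u, v].
Proof.
move=> uv; apply: interval_perfect_in; first exact: interval_is_interval.
move=> x _; have [->|xu] := eqVneq x u.
  by exists v; rewrite ?gt_eqF//= in_itv/= lexx ltW.
by exists u; rewrite 1?eq_sym//= in_itv/= lexx ltW.
Qed.

Lemma perfect_itvoo (u v : R) : perfect_in `]u, v[.
Proof.
apply: interval_perfect_in; first exact: interval_is_interval.
move=> x /=; rewrite in_itv/= => /andP[ux xv].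
exists ((x + v) / 2); last by rewrite gt_eqF// midf_lt.
by rewrite /= in_itv/= (lt_trans ux) ?midf_lt.
Qed.

Lemma tower_nderive n D F f : perfect_in D -> tower n D F ->
  {in D, f =1 F 0} ->
  forall j, leo (Some j) n -> {in D, nderive_in D j f =1 F j}.
Proof.
move=> pD [dF _] fF; elim=> [|j IH] jn; first exact: fF.
move=> x; rewrite inE => Dx; rewrite /nderive_in /= /derive_in.
have pDx := pD x Dx; apply/cvg_lim => //.
apply: cvg_trans (dF j jn x Dx); apply: diff_quot_eq_cvg => // y Dy.
by rewrite -IH//; exact: leoS.
Qed.

Lemma class_C_tower n D f :
  class_C n D f -> tower n D (fun j => nderive_in D j f).
Proof.
move=> Cf; split=> [j jn x Dx|k kn]; last exact: (Cf k kn).2.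
exact: (Cf _ jn).1.
Qed.

Lemma tower_class_C n D F f : perfect_in D -> tower n D F ->
  {in D, f =1 F 0} -> class_C n D f.
Proof.
move=> pD tF fF k kn.
have eF := tower_nderive n D F f pD tF fF.
have [dn cn] : tower n D (fun j => nderive_in D j f).
  by apply: tower_eq tF => j jn x Dx; rewrite eF.
split=> [j jk x Dx|]; last exact: cn.
apply/cvg_ex; exists (nderive_in D j.+1 f x); apply: dn => //.
exact: leo_trans kn.
Qed.

(** The tower of f on D restricts to a tower on A, and uniqueness of derivatives
    on A does the rest.  This identifies the one-sided derivatives of f and g on
    the middle interval with their two-sided ones at the joints. *)
Lemma nderive_in_subset n A D f f1 : perfect_in A -> A `<=` D ->
  class_C n D f -> {in A, f1 =1 f} ->
  class_C n A f1 /\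
  forall j, leo (Some j) n -> {in A, nderive_in A j f1 =1 nderive_in D j f}.
Proof.
move=> pA AD /class_C_tower/(tower_subset _ _ _ _ AD) tf ff1.
by split; [exact: tower_class_C tf ff1|exact: tower_nderive tf ff1].
Qed.

Lemma tower_itvU n F (u v w : R) : u < v -> v < w ->
  tower n `[u, v] F -> tower n `[v, w] F -> tower n `[u, w] F.
Proof.
move=> uv vw t1 t2; have -> : `[u, w]%classic = `[u, v] `|` `[v, w].
  apply/seteqP; split=> x /=; rewrite !in_itv/=.
    move=> /andP[ux xw]; rewrite ux xw andbT/=.
    by case: (leP x v) => [|/ltW]; [left|right].
  case=> /andP[lx xr]; first by rewrite lx (le_trans xr)// ltW.
  by rewrite xr (le_trans _ lx)// ltW.
by apply: tower_setU => //; exact: interval_closed.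
Qed.

Lemma class_C_at_joint n F f (u v w : R) : u < v -> v < w ->
  tower n `[u, v] F -> tower n `[v, w] F -> f =1 F 0 -> class_C_at n f v.
Proof.
move=> uv vw t1 t2 fF k kn; have t := tower_itvU n F u v w uv vw t1 t2.
exists (Num.min (v - u) (w - v)); first by rewrite lt_min !subr_gt0 uv.
apply: tower_class_C (perfect_itvoo _ _) _ (fun x _ => fF x).
apply: tower_subset (tower_leo _ _ _ _ kn t) => x /=; set e := Num.min _ _.
have eu : e <= v - u by rewrite ge_min lexx.
have ew : e <= w - v by rewrite ge_min lexx orbT.
by rewrite !in_itv/= => /andP[xu xw]; apply/andP; split; lra.
Qed.

End Towers.

(** * The transition function *)

Theorem theorem1 (R : realType) (a a0 b0 b : R)
    (ha : a < a0) (hab : a0 < b0) (hb : b0 < b)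
    (l r q : xnat) (hl : leo l q) (hr : leo r q)
    (BL BR : (R -> R) -> (R -> R))
    (hBL : leftward_blend a0 b0 q l r BL)
    (hBR : rightward_blend a0 b0 q l r BR)
    (f g : R -> R)
    (hf : class_C q `[a, b0] f) (hg : class_C q `[a0, b] g) :
  let f0 := BR (f \_ `[a0, b0]) in
  let g0 := BL (g \_ `[a0, b0]) in
  let h0 := fun x => f0 x + g0 x in
  let h := fun x => if x < a0 then f x else if x <= b0 then h0 x else g x in
  [/\ class_C q `[a0, b0] h0,
      forall j : nat, leo (Some j) l ->
        nderive_in `[a0, b0] j h0 a0 = nderive_in `[a, b0] j f a0,
      forall k : nat, leo (Some k) r ->
        nderive_in `[a0, b0] k h0 b0 = nderive_in `[a0, b] k g b0
    & smooth_transition a a0 b0 b l r f g h].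
Proof.
move=> f0 g0 h0 h.
have subf : `[a0, b0] `<=` `[a, b0] by apply/subset_itvr; rewrite bnd_simp ltW.
have subg : `[a0, b0] `<=` `[a0, b] by apply/subset_itvl; rewrite bnd_simp ltW.
have p0 := perfect_itvcc a0 b0 hab.
have restr (u : R -> R) : {in `[a0, b0]%classic, u \_ `[a0, b0] =1 u}.
  by move=> x x0; rewrite patchT.
have [Cf nf] := nderive_in_subset _ _ _ _ _ p0 subf hf (restr f).
have [Cg ng] := nderive_in_subset _ _ _ _ _ p0 subg hg (restr g).
have [[CBR _] /(_ _ Cf)[f0a f0b]] := hBR.
have [[CBL _] /(_ _ Cg)[g0a g0b]] := hBL.
have th0 := towerD _ _ _ _ (class_C_tower _ _ _ (CBR _ Cf))
                           (class_C_tower _ _ _ (CBL _ Cg)).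
have Ch0 : class_C q `[a0, b0] h0 by exact: tower_class_C th0 _.
have nh0 := tower_nderive q _ _ h0 p0 th0 (fun x _ => erefl).
have in_a0 : a0 \in `[a0, b0]%classic by rewrite inE/= in_itv/= lexx ltW.
have in_b0 : b0 \in `[a0, b0]%classic by rewrite inE/= in_itv/= lexx ltW.
have h0a j : leo (Some j) l ->
    nderive_in `[a0, b0] j h0 a0 = nderive_in `[a, b0] j f a0.
  move=> jl; have jq := leo_trans _ _ _ jl hl.
  by rewrite nh0// f0a// g0a// addr0 nf.
have h0b k : leo (Some k) r ->
    nderive_in `[a0, b0] k h0 b0 = nderive_in `[a0, b] k g b0.
  move=> kr; have kq := leo_trans _ _ _ kr hr.
  by rewrite nh0// f0b// g0b// add0r ng.
split=> //.
have l0 : leo (Some 0) l by case: (l).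
have r0 : leo (Some 0) r by case: (r).
(* Beyond order l the values of H j may jump at a0, and beyond order r at b0;
   hence the three different orders of the towers below. *)
pose H j x := if x < a0 then nderive_in `[a, b0] j f x
  else if x <= b0 then nderive_in `[a0, b0] j h0 x
  else nderive_in `[a0, b] j g x.
have HL j : leo (Some j) l ->
    {in `[a, a0]%classic, nderive_in `[a, b0] j f =1 H j}.
  move=> jl x; rewrite inE/= in_itv/= => /andP[_]; rewrite /H.
  by case: ltgtP => // -> _; rewrite ltW// h0a.
have HM j : {in `[a0, b0]%classic, nderive_in `[a0, b0] j h0 =1 H j}.
  move=> x; rewrite inE/= in_itv/= /H => /andP[a0x ->].
  by rewrite ltNge a0x.
have HR j : leo (Some j) r ->
    {in `[b0, b]%classic, nderive_in `[a0, b] j g =1 H j}.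
  move=> jr x; rewrite inE/= in_itv/= /H => /andP[b0x _].
  rewrite ltNge (le_trans (ltW hab) b0x)/=.
  by case: ltgtP b0x => // <- _; rewrite h0b.
have tL : tower l `[a, a0] H.
  apply: tower_eq HL _; apply: tower_leo hl _.
  apply: tower_subset (class_C_tower _ _ _ hf).
  by apply/subset_itvl; rewrite bnd_simp ltW.
have tM : tower q `[a0, b0] H.
  by apply: tower_eq (class_C_tower _ _ _ Ch0) => j _; exact: HM.
have tR : tower r `[b0, b] H.
  apply: tower_eq HR _; apply: tower_leo hr _.
  apply: tower_subset (class_C_tower _ _ _ hg).
  by apply/subset_itvr; rewrite bnd_simp ltW.
have ab0 : a < b0 := lt_trans ha hab.
have tH : tower (mino l r) `[a, b] H.
  have tL' := tower_leo _ _ _ _ (leo_minl l r) tL.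
  have tM' := tower_leo _ _ _ _ (leo_trans _ _ _ (leo_minl l r) hl) tM.
  have tR' := tower_leo _ _ _ _ (leo_minr l r) tR.
  by apply: tower_itvU ab0 hb _ tR'; exact: tower_itvU ha hab tL' tM'.
split.
- have pab := perfect_itvcc a b (lt_trans ab0 hb).
  exact: tower_class_C pab tH (fun x _ => erefl).
- by move=> x xa; apply/esym/(HL 0 l0); rewrite inE.
- by move=> x xb; apply/esym/(HR 0 r0); rewrite inE.
- have tM' := tower_leo _ _ _ _ hl tM.
  exact: class_C_at_joint ha hab tL tM' (fun _ => erefl).
- have tM' := tower_leo _ _ _ _ (maxo_leo _ _ _ hl hr) tM.
  have tI : tower (maxo l r) `]a0, b0[ H.
    by apply: tower_subset tM' => x; exact: subset_itv_oo_cc.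
  exact: tower_class_C (perfect_itvoo a0 b0) tI (fun x _ => erefl).
- have tM' := tower_leo _ _ _ _ hr tM.
  exact: class_C_at_joint hab hb tM' tR (fun _ => erefl).
Qed.
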